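(* Let $m,n\ge1$ and $\Theta\in\mathbb{R}^{m\times n}$ with best approximation sequence $(\underline z_k)_{k\ge1}$. (i) For every $\epsilon>0$ there is $k_0(\epsilon)$ such that for every $k\ge k_0(\epsilon)$, if \[\widehat w(\Theta)>\frac{\tau_{k+1}+\tau_k^{-1}}{\sigma_k-1}+\epsilon,\] then $\underline z_k,\underline z_{k+1},\underline z_{k+2}$ are linearly independent. (ii) Assume $\underline\sigma>1$ and $\overline\tau<\infty$. If the integer $\ell\ge1$ satisfies \[\ell<1+\frac{\log\Big((\overline\tau-1)\big(\widehat w(\Theta)(\underline\sigma-1)+1-\frac{1}{\underline\tau}\big)+1\Big)}{\log\overline\tau},\] then for all sufficiently large $k$ the vectors $\underline z_k,\underline z_{k+1},\dots,\underline z_{k+\ell-1}$ are linearly independent. In particular, a sufficient condition for this conclusion is \[\ell<1+\frac{\log\big(\widehat w(\Theta)(\overline\tau-1)(\underline\sigma-1)+1\big)}{\log\overline\tau}.\]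
   Context: Let $\Theta^{E}=(\Theta\mid I_m)$, so $\Theta^E\underline z=\Theta\underline x+\underline y$ for $\underline z=(\underline x,\underline y)\in\mathbb{Z}^n\times\mathbb{Z}^m$; $\|\cdot\|$ is the maximum norm. $\widehat w(\Theta)$ is the supremum of $\widehat w$ such that for every sufficiently large $X$ there is $\underline z\in\mathbb{Z}^{n+m}\setminus\{0\}$ with $\|\underline z\|\le X$, $\|\Theta^E\underline z\|<X^{-\widehat w}$. Standing assumption: the columns of $\Theta^E$ are $\mathbb{Q}$-linearly independent and the sequence of best approximations $(\underline z_k)_{k\ge1}$ is unique up to sign: nonzero integer vectors with $\|\underline z_1\|<\|\underline z_2\|<\cdots$ such that $\|\Theta^E\underline z_k\|>0$ is minimal among $\|\Theta^E\underline z\|$ over nonzero integer $\underline z$ with $\|\underline z\|<\|\underline z_{k+1}\|$; then $\|\Theta^E\underline z_k\|$ is strictly decreasing. Define $\sigma_k=\log\|\Theta^E\underline z_{k+1}\|/\log\|\Theta^E\underline z_k\|$, $\tau_k=\log\|\underline z_{k+1}\|/\log\|\underline z_k\|$, $\underline\sigma=\liminf_k\sigma_k$, $\underline\tau=\liminf_k\tau_k$, $\overline\tau=\limsup_k\tau_k$.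
   Formalization: Part (i) is stated only for finite ŵ(Θ); when ŵ(Θ)=∞ the inequality holds for all large k and the claim fails (for m=1, n=2 there are Θ with infinitely many linearly dependent consecutive triples). *)

(* Defs.v *)
(* MathComp / MathComp-Analysis *)
From HB Require Import structures.
From mathcomp Require Import all_boot all_order all_algebra.
From mathcomp Require Import all_classical all_reals all_analysis.
Set Implicit Arguments.
Unset Strict Implicit.
Unset Printing Implicit Defensive.
Import Order.TTheory GRing.Theory Num.Theory.
Import numFieldNormedType.Exports.
Local Open Scope classical_set_scope.
Local Open Scope ring_scope.

Section BestApproximations.
Variables (R : realType) (m n : nat) (Theta : 'M[R]_(m, n)).

Definition ThetaE : 'M[R]_(m, n + m) := row_mx Theta 1%:M.

Definition toR (z : 'cV[int]_(n + m)) : 'cV[R]_(n + m) := map_mx intr z.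

(* On matrices, the norm `|A| of the library is the maximum norm. *)
Definition height (z : 'cV[int]_(n + m)) : R := `|toR z|.

Definition error (z : 'cV[int]_(n + m)) : R := `|ThetaE *m toR z|.

(* The value +oo is possible, for instance when m = 1 and n = 2. *)
Definition what : \bar R :=
  ereal_sup [set w%:E | w in [set w : R | \forall X \near +oo,
    exists z : 'cV[int]_(n + m),
      [/\ z != 0, height z <= X & error z < X `^ (- w)]]].

Definition columns_Qfree : Prop :=
  forall q : 'cV[rat]_(n + m), ThetaE *m map_mx ratr q = 0 -> q = 0.

(* Sequences are indexed from 0. The starting point is not normalised: every
   tail of a best approximation sequence is one too, and the liminf, limsup and
   "for all large k" statements below do not depend on it. *)
Definition best_approximations (z : nat -> 'cV[int]_(n + m)) : Prop :=
  forall k,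
    [/\ z k != 0,
        height (z k) < height (z k.+1),
        0 < error (z k)
      & forall u, u != 0 -> height u < height (z k.+1) ->
          error (z k) <= error u].

(* Uniqueness of the sequence up to sign, read term by term: by the remark
   above, two sequences can only be compared up to a shift. *)
Definition unique_up_to_sign (z : nat -> 'cV[int]_(n + m)) : Prop :=
  forall k u, u != 0 -> height u < height (z k.+1) ->
    error u = error (z k) -> u = z k \/ u = - z k.

Variable z : nat -> 'cV[int]_(n + m).

Definition sigma (k : nat) : R := ln (error (z k.+1)) / ln (error (z k)).

Definition tau (k : nat) : R := ln (height (z k.+1)) / ln (height (z k)).

Definition sigma_inf : \bar R := limn_einf (fun k => (sigma k)%:E).

Definition tau_inf : \bar R := limn_einf (fun k => (tau k)%:E).

Definition tau_sup : \bar R := limn_esup (fun k => (tau k)%:E).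

(* z_k, ..., z_(k+l-1) are linearly independent *)
Definition independent_from (k l : nat) : Prop :=
  free [seq toR (z i) | i <- iota k l].

End BestApproximations.

(* Main.v *)
(* Write x_k = log |z_k|, e_k = - log |Theta^E z_k|.  If z_k, ..., z_(k+l-1) are
   dependent but z_(k+1), ..., z_(k+l-1) are not, cofactors give an integer
   relation sum_j a_j z_(k+j) = 0 with a_0 <> 0 and
   |a_j| <= (l-1)! prod_(i <> j) |z_(k+i)|.  Applying Theta^E and using |a_0| >= 1
   and the monotonicity of heights and errors,
     e_(k+1) - e_k <= x_k + x_(k+2) + ... + x_(k+l-1) + O(1).
   On the other hand e_k >= w x_(k+1) for large k whenever 0 <= w < what, since no
   vector of height below |z_(k+1)| has a smaller error than z_k.  Dividing by
   x_(k+1), w (sigma_k - 1) <= 1/tau_k + tau_(k+1) + tau_(k+1) tau_(k+2) + ... + o(1),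
   which contradicts the hypothesis on what.  For l = 3 the independence of the
   last two vectors is automatic; for larger l it follows by induction on l. *)
Require Import Defs.
From HB Require Import structures.
From mathcomp Require Import all_boot all_order all_algebra.
From mathcomp Require Import perm.
From mathcomp Require Import all_classical all_reals all_analysis.
From mathcomp Require Import ring lra zify.
Set Implicit Arguments.
Unset Strict Implicit.
Unset Printing Implicit Defensive.
Import Order.TTheory GRing.Theory Num.Theory.
Import numFieldNormedType.Exports.
Local Open Scope classical_set_scope.
Local Open Scope ring_scope.

(** * Bounded integer relations from cofactors *)

Lemma norm_det_le (R : realDomainType) n (A : 'M[R]_n) (b : 'I_n -> R) :
  (forall i j, `|A i j| <= b i) -> `|\det A| <= n`!%:R * \prod_i b i.
Proof.
move=> Ab; rewrite /determinant; apply: (le_trans (ler_norm_sum _ _ _)).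
have -> : n`!%:R * \prod_i b i = \sum_(sg : {perm 'I_n}) \prod_i b i.
  by rewrite sumr_const card_Sn mulr_natl.
apply: ler_sum => s _; rewrite normrM normrX normrN1 expr1n mul1r normr_prod.
by apply: ler_prod => i _; rewrite normr_ge0 Ab.
Qed.

(* Restrict the rows to columns on which rows 1, ..., r have a nonzero minor and
   append an arbitrary further column: the resulting square matrix is singular,
   and the cofactors of the appended column do not depend on that column. *)
Lemma dependent_rows_relation (R : realType) r N (V : 'M[int]_(r.+1, N))
    (b : 'I_r.+1 -> R) :
  (forall i j, `|(V i j)%:~R| <= b i) ->
  row_free (row' ord0 (map_mx intr V : 'M[R]_(_, _))) ->
  ~~ row_free (map_mx intr V : 'M[R]_(_, _)) ->
  exists a : 'I_r.+1 -> int,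
    [/\ a ord0 != 0, forall j, \sum_i V i j * a i = 0
      & forall i, `|(a i)%:~R| <= r`!%:R * \prod_(j < r) b (lift i j)].
Proof.
move=> Vb free_tail dep.
set VR := map_mx intr V in free_tail dep.
have full_tail : row_full (row' ord0 VR)^T by rewrite /row_full mxrank_tr.
pose f := fullrankfun full_tail.
pose D := \matrix_(i < r.+1, j < r) V i (f j).
pose a (i : 'I_r.+1) : int := (-1) ^+ (i + 0) * \det (row' i D).
(* [unlift ord0 j] is [None] only at [j = ord0], so column 0 is the appended column [g] and the
   others are the columns of [D]. *)
have cofE (g : 'I_N) (i : 'I_r.+1) :
    cofactor (\matrix_(i, j) V i (oapp f g (unlift ord0 j))) i ord0 = a i.
  rewrite /a /cofactor; congr (_ * \det _); apply/matrixP => p q.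
  by rewrite !mxE liftK.
exists a; split.
- rewrite /a mul1r.
  have : rowsub f (row' ord0 VR)^T \in unitmx := fullrowsub_unit full_tail.
  rewrite unitmxE unitfE -det_tr.
  have -> : (rowsub f (row' ord0 VR)^T)^T = map_mx intr (row' ord0 D) :> 'M[R]_r.
    by apply/matrixP => p q; rewrite !mxE.
  by rewrite det_map_mx intr_eq0.
- move=> g; pose W := \matrix_(i, j) V i (oapp f g (unlift ord0 j)).
  have : \det W == 0.
    (* A left kernel vector of [V] also kills every matrix assembled from columns of [V], with or
       without repetition. *)
    rewrite -(intr_eq0 R) -det_map_mx; apply/det0P.
    move: dep; rewrite -kermx_eq0 => /rowV0Pn[v /sub_kermxP vV v0].
    exists v => //; apply/rowP => j.
    have /rowP/(_ (oapp f g (unlift ord0 j))) := vV; rewrite !mxE => vV0.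
    by rewrite -[RHS]vV0; apply: eq_bigr => i _; rewrite !mxE.
  move=> /eqP; rewrite (expand_det_col _ ord0) => W0; rewrite -[RHS]W0.
  by apply: eq_bigr => i _; rewrite cofE mxE unlift_none.
- move=> i; rewrite /a rmorphM rmorphXn rmorphN1 normrM normrX normrN1 expr1n.
  rewrite mul1r -det_map_mx; apply: norm_det_le => p q.
  by rewrite !mxE; exact: Vb.
Qed.

(** * Windows of consecutive vectors as integer matrices *)

Section Independence.
Variables (R : realType) (m n : nat).
Implicit Type z : nat -> 'cV[int]_(n + m).

Definition window z k l : 'M[int]_(l, n + m) := \matrix_(i, j) z (k + i)%N j ord0.

Lemma independent_fromE z k l :
  independent_from R z k l = row_free (map_mx intr (window z k l) : 'M[R]_(_, _)).
Proof.
rewrite /independent_from.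
have -> : [seq toR R (z i) | i <- iota k l] =
          [tuple toR R (z (k + i)%N) | i < l] :> seq _.
  by rewrite /= -[X in iota X]addn0 iotaDl -val_enum_ord -!map_comp.
apply/propext; split.
  move/freeP => fr; apply: inj_row_free => v v0; apply/rowP => i; rewrite mxE.
  apply: (fr (fun i => v ord0 i)); apply/colP => j.
  have /rowP/(_ j) := v0; rewrite !mxE => e; rewrite -[RHS]e summxE.
  by apply: eq_bigr => p _; rewrite -tnth_nth tnth_mktuple !mxE.
move=> fr; apply/freeP => c c0 i.
have : \row_i c i *m (map_mx intr (window z k l) : 'M[R]_(_, _)) = 0.
  apply/rowP => j; have /colP/(_ j) := c0; rewrite !mxE => e; rewrite -[RHS]e summxE.
  by apply: eq_bigr => p _; rewrite -tnth_nth tnth_mktuple !mxE.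
rewrite -(mul0mx _ (map_mx intr (window z k l))) => /(row_free_inj fr).
by move/rowP/(_ i); rewrite !mxE.
Qed.

End Independence.

Lemma mx_entry_le (R : realType) p q (A : 'M[R]_(p, q)) i j : `|A i j| <= `|A|.
Proof.
by rewrite [leRHS]/Num.norm /= mx_normrE; apply: (le_bigmax _ _ (i, j)).
Qed.

(** * Growth of heights and decay of errors *)

Section BestApproximationSequence.
Variables (R : realType) (m n : nat) (Theta : 'M[R]_(m, n)).
Variable z : nat -> 'cV[int]_(n + m).

Local Notation height := (height R).
Local Notation error := (error Theta).

(** The maximum norm is attained at an entry, which is an integer. This integrality is what forces
    strictly increasing heights to tend to infinity. *)
Lemma height_nat (u : 'cV[int]_(n + m)) : u != 0 -> exists N, height u = N.+1%:R.
Proof.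
move=> u0; have u0' : mx_norm (toR R u) != 0.
  apply: contra u0 => /eqP/mx_norm_eq0 /matrixP e; apply/eqP/matrixP => i j.
  by have := e i j; rewrite !mxE => /eqP; rewrite intr_eq0 => /eqP.
have [[i j] /= ne] := mx_norm_neq0 u0'.
have hE : height u = `|u i j|%N%:R by rewrite /height [LHS]ne mxE natr_absz intr_norm.
case N0 : `|u i j|%N hE => [|N] hE; last by exists N.
by move: u0'; rewrite ne -[`|_|]/(`|_|) mxE -intr_norm -natr_absz N0 eqxx.
Qed.

Hypothesis hz : best_approximations Theta z.

Lemma z_neq0 k : z k != 0. Proof. by have [] := hz k. Qed.

Lemma error_gt0 k : 0 < error (z k). Proof. by have [] := hz k. Qed.

Lemma error_le k u : u != 0 -> height u < height (z k.+1) -> error (z k) <= error u.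
Proof. by have [_ _ _] := hz k; apply. Qed.

Lemma height_ltS k : height (z k) < height (z k.+1). Proof. by have [] := hz k. Qed.

Lemma height_ge_index k : k.+1%:R <= height (z k).
Proof.
elim: k => [|k IH].
  by have [N ->] := height_nat (z_neq0 0); rewrite ler_nat.
have [N e] := height_nat (z_neq0 k.+1); rewrite e ler_nat.
by have := le_lt_trans IH (height_ltS k); rewrite e ltr_nat.
Qed.

Lemma height_gt0 k : 0 < height (z k).
Proof. exact: lt_le_trans (height_ge_index k). Qed.

Lemma height_unbounded (M : R) : exists k0, forall k, (k0 <= k)%N -> M < height (z k).
Proof.
exists (Num.truncn M) => k k0; apply: (lt_le_trans (truncnS_gt M)).
by apply: le_trans (height_ge_index k); rewrite ler_nat.
Qed.

Lemma log_height_unbounded (M : R) :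
  exists k0, forall k, (k0 <= k)%N -> M < ln (height (z k)).
Proof.
have [k0 H] := height_unbounded (expR M); exists k0 => k /H Mk.
by rewrite -ltr_expR lnK // posrE height_gt0.
Qed.

Lemma log_height_ltS k : ln (height (z k)) < ln (height (z k.+1)).
Proof. by rewrite ltr_ln ?posrE ?height_gt0 // height_ltS. Qed.

(* The columns e_1 and -floor(Theta e_1) give fractional parts, hence an error
   below 1. *)
Lemma exists_error_lt1 : (0 < n)%N -> exists2 u, u != 0 & error u < 1.
Proof.
move=> n0; pose i0 := Ordinal n0.
pose x : 'cV[int]_n := \col_i (i == i0)%:Z.
pose y : 'cV[int]_m := \col_i (- Num.floor (Theta i i0)).
exists (col_mx x y).
  apply/eqP => /colP/(_ (lshift m i0)); rewrite col_mxEu !mxE eqxx; exact/eqP.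
have -> : error (col_mx x y) = `|\col_i (Theta i i0 - (Num.floor (Theta i i0))%:~R)|.
  rewrite /error /ThetaE /toR map_col_mx mul_row_col mul1mx; congr `|_|.
  apply/colP => i; rewrite !mxE rmorphN (bigD1 i0) //= big1 => [|j /negPf ji].
    by rewrite !mxE eqxx mulr1 addr0.
  by rewrite !mxE ji mulr0.
rewrite [ltLHS]/Num.norm /= mx_normrE; apply: bigmax_lt => // -[i j] _ /=.
rewrite mxE ger0_norm ?subr_ge0 ?floor_le // ltrBlDl.
by have := floorD1_gt (Theta i i0); rewrite rmorphD /=.
Qed.

(** For the exponent 0 the required bound is 1, so one fixed vector of error below 1 serves every
    large [X]. *)
Lemma what_ge0 : (0 < n)%N -> (0 <= what Theta)%E.
Proof.
move=> /exists_error_lt1[u u0 eu]; apply: ereal_sup_ubound; exists 0 => //=.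
exists (height u); split; first exact: num_real.
by move=> X uX; exists u; split => //; rewrite ?ltW // oppr0 powRr0.
Qed.

Lemma eventually_error_lt1 : (0 < n)%N ->
  exists k0, forall k, (k0 <= k)%N -> error (z k) < 1.
Proof.
move=> /exists_error_lt1[u u0 eu]; have [k0 H] := height_unbounded (height u).
exists k0 => k kk0; apply: le_lt_trans eu; apply: error_le => //.
by apply: H; rewrite leqW.
Qed.

(** If the bound failed, the definition of [what], used with some [w' > w] at a suitable [X] below
    the height of [z k.+1], would give a vector with smaller error than [z k]. *)
Lemma error_le_pow_height (w : R) : (0 < n)%N -> 0 <= w -> (w%:E < what Theta)%E ->
  exists k0, forall k, (k0 <= k)%N -> w * ln (height (z k.+1)) <= - ln (error (z k)).
Proof.
move=> n0 w0 /ereal_sup_gt[_ [w' [M [_ HM]] <-]]; rewrite lte_fin => ww'.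
have [k1 H1] := height_unbounded M.
have [k2 H2] := eventually_error_lt1 n0.
exists (maxn k1 k2) => k; rewrite geq_max => /andP[/H1 Mk /H2 ek].
rewrite leNgt; apply/negP => Lw.
have wpos : 0 < w.
  rewrite lt_neqAle w0 andbT; apply/negP => /eqP w00; move: Lw.
  by rewrite -w00 mul0r oppr_lt0 ltNge ln_le0 // ltW.
(* At [Y] the power with exponent [- w] equals [error (z k)], and [Lw] places [Y] below the next
   height. The maximum with [height (z k)] keeps [X] above [M] and at least 1. *)
pose Y := expR (- ln (error (z k)) / w); pose X := Num.max Y (height (z k)).
have YX : Y < height (z k.+1).
  rewrite -[ltRHS]lnK ?posrE ?height_gt0 // ltr_expR ltr_pdivrMr // mulrC //.
have XX : X < height (z k.+1) by rewrite gt_max YX height_ltS.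
have MX : M < X by rewrite lt_max Mk orbT.
have X1 : 1 <= X.
  by rewrite le_max (le_trans _ (height_ge_index k)) ?orbT // ler1n.
have X0 : 0 < X by exact: lt_le_trans X1.
have [u [u0 uX]] := HM _ MX.
have := error_le u0 (le_lt_trans uX XX) => /le_lt_trans/[apply].
rewrite -ltr_ln ?posrE ?error_gt0 ?powR_gt0 // ln_powR.
have lnYX : ln Y <= ln X by rewrite ler_ln ?posrE ?expR_gt0 // le_max lexx.
have lnYE : w * ln Y = - ln (error (z k)) by rewrite expRK mulrC divfK // gt_eqF.
have lnX0 : 0 <= ln X by rewrite ln_ge0.
have : w * ln X <= w' * ln X by rewrite ler_wpM2r // ltW.
have : w * ln Y <= w * ln X by rewrite ler_wpM2l.
by rewrite lnYE; lra.
Qed.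

(** * The inequality forced by a dependent window *)

Hypothesis hu : unique_up_to_sign Theta z.

(** [z k] competes with [z k.+1] below the height of [z k.+2]. Equal errors would make the two
    vectors equal up to sign, hence of equal height. *)
Lemma error_ltS k : error (z k.+1) < error (z k).
Proof.
rewrite lt_neqAle error_le ?z_neq0 ?(lt_trans (height_ltS _) (height_ltS _)) //.
rewrite andbT; apply/negP => /eqP/esym e.
have := hu (z_neq0 k) (lt_trans (height_ltS _) (height_ltS _)) e.
have hN u : height (- u) = height u.
  rewrite /height /toR -[in RHS]normrN; congr `|_|.
  by apply/colP => i; rewrite !mxE rmorphN.
by case=> ek; have := height_ltS k; rewrite ek ?hN ltxx.
Qed.

Lemma log_error_ltS k : ln (error (z k.+1)) < ln (error (z k)).
Proof. by rewrite ltr_ln ?posrE ?error_gt0 // error_ltS. Qed.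

Lemma error_leq i j : (i <= j)%N -> error (z j) <= error (z i).
Proof.
move=> /subnK <-; elim: (j - i)%N => [|d IH] //; rewrite addSn.
exact: le_trans (ltW (error_ltS _)) IH.
Qed.

Lemma height_leq i j : (i <= j)%N -> height (z i) <= height (z j).
Proof.
move=> /subnK <-; elim: (j - i)%N => [|d IH] //; rewrite addSn.
exact: le_trans IH (ltW (height_ltS _)).
Qed.

Lemma tail_window k r :
  row' ord0 (window z k r.+1) = window z k.+1 r.
Proof. by apply/matrixP => i j; rewrite !mxE /= addnS. Qed.

(* In an integer relation sum_i a_i z_(k+i) = 0 the coefficient a_0 is a nonzero
   integer, so error z_k is at most the error of the remaining terms. *)
Lemma dependent_error_le k r :
  independent_from R z k.+1 r.+1 -> ~ independent_from R z k r.+2 ->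
  error (z k) <= (r.+1 * r.+1`!)%:R *
    (height (z k) * \prod_(j < r) height (z (k + j.+2)%N)) * error (z k.+1).
Proof.
rewrite !independent_fromE -tail_window => fr /negP dep.
pose b (i : 'I_r.+2) := height (z (k + i)%N).
have Vb i j : `|(window z k r.+2 i j)%:~R| <= b i.
  by have := mx_entry_le (toR R (z (k + i)%N)) j ord0; rewrite !mxE.
have fr' : row_free (row' ord0 (map_mx intr (window z k r.+2) : 'M[R]_(_, _))).
  by rewrite -map_row'.
have [a [a0 rel a_le]] := dependent_rows_relation Vb fr' dep.
have err0 : \sum_i (a i)%:~R *: (ThetaE Theta *m toR R (z (k + i)%N)) = 0.
  under eq_bigr do rewrite scalemxAr.
  rewrite -mulmx_sumr (_ : \sum_i _ = 0) ?mulmx0 //.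
  apply/colP => j; rewrite summxE mxE -[RHS]/(0%:~R) -(rel j) rmorph_sum /=.
  by apply: eq_bigr => i _; rewrite !mxE rmorphM mulrC.
rewrite big_ord_recl addn0 in err0.
set P := height (z k) * _; have P0 : 0 <= P.
  by rewrite mulr_ge0 ?prodr_ge0 // => *; exact/ltW/height_gt0.
have step (i : 'I_r.+1) :
    `|(a (lift ord0 i))%:~R *: (ThetaE Theta *m toR R (z (k + lift ord0 i)%N))| <=
    r.+1`!%:R * P * error (z k.+1).
  rewrite normrZ; apply: ler_pM => //.
    apply: le_trans (a_le _) _; rewrite ler_wpM2l //.
    (* Among the products omitting one row other than row 0, the one omitting row 1 is largest,
       since heights increase. *)
    apply: (@le_trans _ _ (\prod_(j < r.+1) b (lift (lift ord0 ord0) j))).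
      apply: ler_prod => j _; rewrite ltW ?height_gt0 //=; apply: height_leq.
      rewrite leq_add2l /= /bump /= leq_add2r.
      by case: leqP => // ij; rewrite (leq_trans _ ij).
    rewrite big_ord_recl /b /= addn0 ler_wpM2l ?(ltW (height_gt0 _)) //.
  by apply: error_leq; rewrite /= /bump; lia.
have a01 : 1 <= `|(a ord0)%:~R| :> R.
  by rewrite -intr_norm -[1]/(1%:~R) ler_int -gtz0_ge1 normr_gt0.
have e0 : error (z k) <= `|(a ord0)%:~R *: (ThetaE Theta *m toR R (z k))|.
  by rewrite normrZ -/(error (z k)) ler_peMl // ltW // error_gt0.
apply: (le_trans e0); move/eqP: err0; rewrite addr_eq0 => /eqP ->; rewrite normrN.
apply: (le_trans (ler_norm_sum _ _ _)); apply: (le_trans (ler_sum _ (fun i _ => step i))).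
by rewrite sumr_const card_ord -[leLHS]mulr_natl natrM !mulrA.
Qed.

(** The constant depends on [r] but not on [k], so it becomes negligible against the unbounded
    logarithms of heights. *)
Lemma dependent_log_error_le r : exists c : R, forall k,
  independent_from R z k.+1 r.+1 -> ~ independent_from R z k r.+2 ->
  ln (error (z k)) <= c + ln (height (z k)) +
    \sum_(j < r) ln (height (z (k + j.+2)%N)) + ln (error (z k.+1)).
Proof.
exists (ln (r.+1 * r.+1`!)%:R) => k /dependent_error_le/[apply].
have c0 : 0 < (r.+1 * r.+1`!)%:R :> R by rewrite ltr0n muln_gt0 fact_gt0.
have P0 : 0 < \prod_(j < r) height (z (k + j.+2)%N).
  by rewrite prodr_gt0 // => *; exact: height_gt0.
have -> : \sum_(j < r) ln (height (z (k + j.+2)%N)) =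
          ln (\prod_(j < r) height (z (k + j.+2)%N)).
  elim: r {c0 P0} => [|r IH]; first by rewrite !big_ord0 ln1.
  rewrite !big_ord_recr /= lnM ?posrE ?IH ?height_gt0 //.
  by rewrite prodr_gt0 // => *; exact: height_gt0.
rewrite -ler_ln ?posrE ?mulr_gt0 ?error_gt0 ?height_gt0 //.
by rewrite !lnM ?posrE ?mulr_gt0 ?error_gt0 ?height_gt0 // !addrA.
Qed.

Lemma independent_from1 k : independent_from R z k 1.
Proof.
rewrite /independent_from /= seq1_free; apply/eqP => zk0.
have := height_gt0 k; rewrite /height zk0 normr0 ltxx //.
Qed.

(* A relation between z_k and z_(k+1) would make their heights and their errors
   proportional with the same ratio, but heights increase and errors decrease. *)
Lemma independent_from2 k : independent_from R z k 2.
Proof.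
rewrite independent_fromE; apply: inj_row_free => v v0.
have rel : v ord0 ord0 *: toR R (z k) = - v ord0 (lift ord0 ord0) *: toR R (z k.+1).
  apply/colP => j; have /rowP/(_ j) := v0; rewrite !mxE !big_ord_recl big_ord0.
  by rewrite !mxE addr0 /= addn0 addn1 => /eqP; rewrite addr_eq0 -mulNr => /eqP.
have hE := congr1 Num.norm rel.
have eE := congr1 (fun x => `|ThetaE Theta *m x|) rel.
move: hE eE; rewrite /= -!scalemxAr !normrZ normrN -!/(height _) -!/(error _).
set p := `|v _ _|; set q := `|v _ _| => hE eE.
have q0 : 0 <= q := normr_ge0 _.
have hk := height_gt0 k; have hk1 := height_ltS k; have ek1 := error_ltS k.
have pq0 : p = 0 /\ q = 0.
  have [qz|qn] := eqVneq q 0.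
    split=> //; apply/eqP; move/eqP: hE; rewrite qz mul0r mulf_eq0.
    by rewrite (gt_eqF hk) orbF.
  have qpos : 0 < q by rewrite lt_neqAle eq_sym qn q0.
  have : q < p by rewrite -(ltr_pM2r hk) hE ltr_pM2l.
  by rewrite ltNge -(ler_pM2r (error_gt0 k)) eE ler_pM2l // (ltW ek1).
have [/normr0P/eqP pz /normr0P/eqP qz] := pq0.
apply/rowP => i; rewrite mxE; case: (unliftP ord0 i) => [j ->|-> //].
by rewrite (ord1 j); exact: qz.
Qed.

(** * Independent windows from bounds on [sigma] and [tau] *)

Lemma tau_ge1 k : 0 < ln (height (z k)) -> 1 <= tau R z k.
Proof. by move=> x0; rewrite /tau ler_pdivlMr // mul1r ltW // log_height_ltS. Qed.

Lemma log_height_le_pow (T : R) k0 : 0 <= T ->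
  (forall k, (k0 <= k)%N -> 0 < ln (height (z k)) /\ tau R z k <= T) ->
  forall k j, (k0 <= k)%N -> ln (height (z (k + j)%N)) <= T ^+ j * ln (height (z k)).
Proof.
move=> T0 H k j kk0; elim: j => [|j IH]; first by rewrite addn0 expr0 mul1r.
have [x0] := H _ (leq_trans kk0 (leq_addr j k)).
rewrite /tau ler_pdivrMr // addnS => /le_trans; apply.
by rewrite exprS -mulrA ler_wpM2l.
Qed.

(** Two consecutive vectors are always independent, so the dependence inequality with [r = 1]
    applies at once. It contradicts the assumed gap when [eps / 2] times the log-height outgrows the
    constant. *)
Lemma three_independent (eps w : R) : (0 < n)%N -> 0 < eps -> what Theta = w%:E ->
  exists k0, forall k, (k0 <= k)%N ->
    (tau R z k.+1 + (tau R z k)^-1) / (sigma Theta z k - 1) + eps < w ->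
    independent_from R z k 3.
Proof.
move=> n0 eps0 we.
have [c Hc] := dependent_log_error_le 1.
have [k1 H1] := eventually_error_lt1 n0.
have [k2 H2] := log_height_unbounded (Num.max 0 (w * `|c| / (eps / 2))).
(* The exponent [w - eps / 2] must be nonnegative, hence the guard [eps < w]; it is recovered below
   from the positivity of the fraction in the hypothesis. *)
have [k3 H3] : exists k0, forall k, (k0 <= k)%N -> eps < w ->
    (w - eps / 2) * ln (height (z k.+1)) <= - ln (error (z k)).
  have [epsw|wle] := ltP eps w; last by exists 0%N.
  have [||k3 H3] := error_le_pow_height (w := w - eps / 2) n0.
  - lra.
  - by rewrite we lte_fin; lra.
  by exists k3 => k /H3.
exists (maxn k1 (maxn k2 k3)) => k; rewrite !geq_max => /and3P[k1k k2k k3k].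
apply: contraPP => dep; apply/negP; rewrite -leNgt.
have [a0 b0] := (H2 _ k2k, H2 _ (leqW k2k)).
have {Hc} := Hc k (independent_from2 _) dep; rewrite big_ord1 addn2.
have := H3 _ k3k; have := log_height_ltS k; have := log_height_ltS k.+1.
have := log_error_ltS k; have : ln (error (z k)) < 0.
  by rewrite ln_lt0 // error_gt0 //= H1.
move: a0 b0; rewrite /tau /sigma !gt_max => /andP[a0 aw] /andP[b0 bw].
move: a0 b0 aw bw.
set a := ln (height (z k)); set b := ln (height (z k.+1)).
set d := ln (height (z k.+2)); set e := ln (error (z k)).
set f := ln (error (z k.+1)) => a0 b0 aw bw e0 fe bd ab Hw He.
have -> : (d / b + (b / a)^-1) / (f / e - 1) = (d + a) * - e / (b * (e - f)).
  by field; apply/and5P; split; lra.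
rewrite leNgt; apply/negP; rewrite -ltrBrDr ltr_pdivrMr ?mulr_gt0 ?subr_gt0 // => K.
have epsw : eps < w.
  have p : 0 < (w - eps) * (b * (e - f)).
    by apply: lt_trans K; rewrite mulr_gt0 ?oppr_gt0 // addr_gt0 // (lt_trans b0).
  by rewrite -subr_gt0 -(pmulr_lgt0 _ (_ : 0 < b * (e - f))) // mulr_gt0 ?subr_gt0.
have {}Hw := Hw epsw.
have lower : (d + a) * ((w - eps / 2) * b) <= (d + a) * - e.
  by rewrite ler_wpM2l //; lra.
have upper : (w - eps) * (b * (e - f)) <= (w - eps) * (b * (c + a + d)).
  by rewrite !ler_wpM2l //; lra.
(* Chain [lower], [K] and [upper], then cancel [(w - eps) * b * (a + d)]. *)
have : b * ((d + a) * (eps / 2)) < b * ((w - eps) * c) by nra.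
rewrite ltr_pM2l // => dac.
move: aw; rewrite ltr_pdivrMr ?divr_gt0 // => aw.
have cc : (w - eps) * c <= w * `|c|.
  apply: (@le_trans _ _ ((w - eps) * `|c|)); first by rewrite ler_wpM2l ?ler_norm //; lra.
  by rewrite ler_wpM2r //; lra.
nra.
Qed.

(** With [x] the log-height at [k.+1], dependence would give [w * s * x <= c + (t^-1 + \sum_(j < r)
    T ^+ j.+1) * x], so the positive gap [G] would satisfy [G * x <= c]. This fails for large
    [k]. *)
Lemma window_independent_succ (k0 : nat) (w s t T : R) r :
  0 <= s -> 0 < t -> 0 <= T ->
  (forall k, (k0 <= k)%N ->
     [/\ 0 < ln (height (z k)), ln (error (z k)) < 0, s <= sigma Theta z k - 1,
         t <= tau R z k <= T
       & w * ln (height (z k.+1)) <= - ln (error (z k))]) ->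
  t^-1 + \sum_(j < r) T ^+ j.+1 < w * s ->
  (forall k, (k0 <= k)%N -> independent_from R z k r.+1) ->
  exists k1, forall k, (k1 <= k)%N -> independent_from R z k r.+2.
Proof.
move=> s0 t0 T0 H gap IH; have [c Hc] := dependent_log_error_le r.
set G := w * s - (t^-1 + \sum_(j < r) T ^+ j.+1).
have G0 : 0 < G by rewrite subr_gt0.
have [k1 H1] := log_height_unbounded (c / G).
exists (maxn k0 k1) => k; rewrite geq_max => /andP[kk0 /leqW/H1].
rewrite ltr_pdivrMr // => cG; apply: contrapT => dep.
have {Hc} := Hc k (IH _ (leqW kk0)) dep.
have [x0 e0 sk /andP[tk Tk] wk] := H k kk0.
have HT : forall k, (k0 <= k)%N -> 0 < ln (height (z k)) /\ tau R z k <= T.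
  by move=> i /H[? _ _ /andP[]].
have b0 := (HT _ (leqW kk0)).1.
have tails : \sum_(j < r) ln (height (z (k + j.+2)%N)) <=
    (\sum_(j < r) T ^+ j.+1) * ln (height (z k.+1)).
  rewrite mulr_suml; apply: ler_sum => j _; rewrite -addSnnS.
  by apply: (log_height_le_pow T0 HT); rewrite leqW.
have xt : ln (height (z k)) <= t^-1 * ln (height (z k.+1)).
  by move: tk; rewrite /tau ler_pdivlMr // ler_pdivlMl.
have sE : s * - ln (error (z k)) <= ln (error (z k)) - ln (error (z k.+1)).
  have -> : ln (error (z k)) - ln (error (z k.+1)) =
            (sigma Theta z k - 1) * - ln (error (z k)).
    by rewrite /sigma; field; rewrite lt_eqF.
  by rewrite ler_wpM2r // oppr_ge0 ltW.
have sw : s * (w * ln (height (z k.+1))) <= s * - ln (error (z k)).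
  by rewrite ler_wpM2l.
by move: cG; rewrite /G; lra.
Qed.

(** Induction on [r]: dropping the last power of [T] only weakens the gap condition, so it passes to
    shorter windows. *)
Lemma window_independent (k0 : nat) (w s t T : R) r :
  0 <= s -> 0 < t -> 0 <= T ->
  (forall k, (k0 <= k)%N ->
     [/\ 0 < ln (height (z k)), ln (error (z k)) < 0, s <= sigma Theta z k - 1,
         t <= tau R z k <= T
       & w * ln (height (z k.+1)) <= - ln (error (z k))]) ->
  t^-1 + \sum_(j < r) T ^+ j.+1 < w * s ->
  exists k1, forall k, (k1 <= k)%N -> independent_from R z k r.+2.
Proof.
move=> s0 t0 T0 H; elim: r => [|r IH] gap.
  by exists 0%N => k _; exact: independent_from2.
have [|k1 H1] := IH.
  apply: le_lt_trans gap; rewrite big_ord_recr /= addrA lerDl exprn_ge0 //.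
apply: (@window_independent_succ (maxn k0 k1) w s t T) => // k.
  by rewrite geq_max => /andP[/H].
by rewrite geq_max => /andP[_ /H1].
Qed.

End BestApproximationSequence.

(** * Limits, products and logarithms in the extended reals *)

Section ExtendedReals.
Variable R : realType.

Lemma limn_esup_lt_eventually (u : nat -> \bar R) (c : \bar R) : (limn_esup u < c)%E ->
  exists k0, forall k, (k0 <= k)%N -> (u k < c)%E.
Proof.
rewrite limn_esup_lim (cvg_lim _ (@cvg_esups_inf _ u)) //.
move=> /ereal_inf_lt[_ [k0 _ <-] uc]; exists k0 => k kk0.
by apply: le_lt_trans uc; apply: ereal_sup_ubound; exists k.
Qed.

Lemma limn_einf_gt_eventually (u : nat -> \bar R) (c : \bar R) : (c < limn_einf u)%E ->
  exists k0, forall k, (k0 <= k)%N -> (c < u k)%E.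
Proof.
rewrite limn_einf_lim (cvg_lim _ (@cvg_einfs_sup _ u)) //.
move=> /ereal_sup_gt[_ [k0 _ <-] uc]; exists k0 => k kk0.
by apply: (lt_le_trans uc); apply: ereal_inf_lbound; exists k.
Qed.

Lemma limn_einf_ge (u : nat -> \bar R) (c : \bar R) k0 :
  (forall k, (k0 <= k)%N -> (c <= u k)%E) -> (c <= limn_einf u)%E.
Proof.
move=> H; rewrite limn_einf_lim (cvg_lim _ (@cvg_einfs_sup _ u)) //.
apply: (@le_trans _ _ (einfs u k0)); last by apply: ereal_sup_ubound; exists k0.
by apply: le_ereal_inf_tmp => _ [k kk0 <-]; exact: H.
Qed.

(** Either factor may be [+oo]; this supplies real lower bounds [w] and [s] for [what] and
    [sigma_inf - 1] whose product still exceeds [q]. *)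
Lemma lt_mule_approx (q : R) (a b : \bar R) :
  0 <= q -> (0 <= a)%E -> (0 <= b)%E -> (q%:E < a * b)%E ->
  exists x y : R, [/\ 0 <= x, 0 <= y, (x%:E < a)%E, (y%:E < b)%E & q < x * y].
Proof.
move=> q0; case: a => [a| |] //; case: b => [b| |] //; rewrite ?lee_fin => a0 b0.
- rewrite -EFinM lte_fin => qab.
  have apos : 0 < a by rewrite lt_neqAle a0 andbT; apply: contraPneq qab => <-; lra.
  have bpos : 0 < b by rewrite lt_neqAle b0 andbT; apply: contraPneq qab => <-; lra.
  have qb : q / b < a by rewrite ltr_pdivrMr.
  have qb0 : 0 <= q / b by rewrite divr_ge0.
  (* Any [x] strictly between [q / b] and [a] leaves room for [y] between [q / x] and [b]. *)
  pose x := (q / b + a) / 2.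
  have x0 : 0 < x by rewrite /x; lra.
  have qx : q / x < b by rewrite ltr_pdivrMr // mulrC -ltr_pdivrMr // /x; lra.
  have qx0 : 0 <= q / x by rewrite divr_ge0 // ltW.
  exists x, ((q / x + b) / 2); rewrite !lte_fin; split; rewrite ?(ltW x0) //.
  + by lra.
  + by rewrite /x; lra.
  + by lra.
  + by rewrite mulrC -ltr_pdivrMr //; lra.
(* The convention [0 * +oo = 0] rules out [a = 0], because [0 <= q]. *)
- move=> qa; have apos : 0 < a.
    rewrite lt_neqAle a0 andbT; apply: contraPneq qa => <-.
    by rewrite mul0e lte_fin; apply/negP; rewrite -leNgt.
  have q2 : 0 <= q / (a / 2) by rewrite divr_ge0 // divr_ge0.
  exists (a / 2), (q / (a / 2) + 1); rewrite lte_fin ltry; split=> //; try lra.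
  by rewrite mulrDr mulrC divfK; lra.
- move=> qb; have bpos : 0 < b.
    rewrite lt_neqAle b0 andbT; apply: contraPneq qb => <-.
    by rewrite mule0 lte_fin; apply/negP; rewrite -leNgt.
  have q2 : 0 <= q / (b / 2) by rewrite divr_ge0 // divr_ge0.
  exists (q / (b / 2) + 1), (b / 2); rewrite lte_fin ltry; split=> //; try lra.
  by rewrite mulrDl divfK; lra.
- by move=> _; exists (q + 1), 1; rewrite !ltry; split=> //; lra.
Qed.

(** Right continuity of a polynomial. The ratios [tau] may exceed their limsup [T], so a slightly
    larger bound [T'] has to be affordable. *)
Lemma geometric_sum_continuity r (T d : R) : 0 < d ->
  exists2 T', T < T' & \sum_(j < r) T' ^+ j.+1 < \sum_(j < r) T ^+ j.+1 + d.
Proof.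
move=> d0; pose p : {poly R} := \sum_(j < r) 'X^(j.+1).
have pE x : p.[x] = \sum_(j < r) x ^+ j.+1.
  by rewrite horner_sum; under eq_bigr do rewrite hornerXn.
have pT : p.[x] @[x --> T^'+] --> p.[T].
  by apply: cvg_at_right_filter; exact: continuous_horner.
have near_lt : \forall x \near T^'+, p.[x] < p.[T] + d.
  by apply: (cvgr_lt _ pT); rewrite ltrDl.
have [x [Tx px]] := filter_ex (filterI (nbhs_right_gt T) near_lt).
by exists x; rewrite // -!pE.
Qed.

(* Exponentiating turns the logarithmic condition into
   [T ^ (r+1) < (T-1)(P+1-1/t)+1], that is 1/t + T + ... + T^r < P. *)
Lemma log_condition_sum (P : \bar R) (t T : R) r :
  (0 <= P)%E -> 1 <= t -> 1 < T ->
  (r.+2%:R%:E < 1 + lne ((T%:E - 1) * (P + 1 - 1 / t%:E) + 1) / lne T%:E)%E ->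
  ((t^-1 + \sum_(j < r) T ^+ j.+1)%:E < P)%E.
Proof.
case: P => [p| |] // p0 t1 T1; last by rewrite ltry.
have T0 : 0 < T by lra.
have t0 : t != 0 by rewrite gt_eqF //; lra.
have lnT : 0 < ln T by rewrite ln_gt0.
have ti : t^-1 <= 1 by rewrite invf_le1 //; lra.
rewrite inver (negPf t0) mul1e.
rewrite (_ : (_ * _ + 1)%E = ((T - 1) * (p + 1 - t^-1) + 1)%:E) //.
rewrite lee_fin in p0.
have B1 : 0 < (T - 1) * (p + 1 - t^-1) + 1.
  have : 0 <= (T - 1) * (p + 1 - t^-1) by rewrite mulr_ge0 //; lra.
  lra.
rewrite !lne_EFin // inver gt_eqF // -EFinM -EFinD !lte_fin -ltrBlDl.
rewrite ltr_pdivlMr // -natr1 addrK mulr_natl -lnXn //.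
rewrite ltr_ln ?posrE ?exprn_gt0 // -ltrBlDr subrX1 ltr_pM2l; last lra.
(* The term [T ^+ 0] of the geometric sum cancels the [1] in [p + 1 - t^-1]. *)
rewrite big_ord_recl expr0 /=; lra.
Qed.

End ExtendedReals.

(** * From limits to bounds valid for all large indices *)

Section IndependentWindows.
Variables (R : realType) (m n : nat) (Theta : 'M[R]_(m, n)).
Variable z : nat -> 'cV[int]_(n + m).
Hypotheses (n0 : (0 < n)%N) (hz : best_approximations Theta z).
Hypotheses (hu : unique_up_to_sign Theta z).
Hypotheses (hS : (1 < sigma_inf Theta z)%E) (hT : (tau_sup R z < +oo)%E).

(** Once log-heights are positive their growth gives [1 <= tau], so both limits lie between 1 and a
    finite bound. *)
Lemma tau_limits : exists t T : R,
  [/\ tau_inf R z = t%:E, tau_sup R z = T%:E, 1 <= t & t <= T].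
Proof.
have [k0 H0] := log_height_unbounded hz 0.
have t1 : (1%:E <= tau_inf R z)%E.
  by apply: (@limn_einf_ge _ _ _ k0) => k /H0; rewrite lee_fin; exact: tau_ge1.
have tT : (tau_inf R z <= tau_sup R z)%E by exact: limn_einf_sup.
case: (tau_sup R z) hT tT => [T| |] // _; last first.
  by move/(le_trans t1).
case: (tau_inf R z) t1 => [t| |] //; rewrite !lee_fin => t1 tT.
by exists t, T.
Qed.

Lemma what_sigma_ge0 : (0 <= what Theta * (sigma_inf Theta z - 1))%E.
Proof. by rewrite mule_ge0 ?(what_ge0 Theta n0) // sube_ge0 // ltW. Qed.

Lemma eventually_window_independent l : (1 <= l)%N ->
  (l%:R%:E < 1 + lne ((tau_sup R z - 1) *
      (what Theta * (sigma_inf Theta z - 1) + 1 - 1 / tau_inf R z) + 1)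
    / lne (tau_sup R z))%E ->
  exists k0, forall k, (k0 <= k)%N -> independent_from R z k l.
Proof.
case: l => [//|[|r]] _; first by exists 0%N => k _; exact: (independent_from1 hz).
have [t [T [tE TE t1 tT]]] := tau_limits; rewrite tE TE => cond.
(* For [T = 1] the numerator is [lne 1 = 0], and 0 times anything is 0, so the condition would read
   [r.+2 < 1]. *)
have [T1|T1] := eqVneq T 1.
  move: cond; rewrite T1 subee // mul0e add0e lne1 mul0e adde0 lte_fin.
  by rewrite ltNge ler1n.
have {}T1 : 1 < T by rewrite lt_neqAle eq_sym T1 (le_trans t1).
have := log_condition_sum what_sigma_ge0 t1 T1 cond.
set q := _ + _ => qP.
have q0 : 0 <= q.
  rewrite addr_ge0 ?invr_ge0 ?sumr_ge0 // => [|j _]; first lra.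
  by rewrite exprn_ge0 //; lra.
have := lt_mule_approx q0 (what_ge0 Theta n0) _ qP.
case; first by rewrite sube_ge0 // ltW.
move=> w [s [w0 s0 wW sS qws]].
(* Half of the slack [w * s - q] pays for replacing [t] by [t'], the other half for replacing [T] by
   [T']. *)
pose d := (w * s - q) / 2; have d0 : 0 < d by rewrite /d; lra.
have [T' TT' HT'] := geometric_sum_continuity r T d0.
have ti0 : 0 < t^-1 by rewrite invr_gt0; lra.
pose t' := (t^-1 + d)^-1.
have t'0 : 0 < t' by rewrite invr_gt0; lra.
have t't : t' < t.
  by rewrite /t' -[ltRHS]invrK ltf_pV2 ?posrE //; lra.
have sS' : ((s + 1)%:E < sigma_inf Theta z)%E by rewrite EFinD -lteBrDr.
have [k1 H1] := limn_einf_gt_eventually sS'.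
have tt : (t'%:E < tau_inf R z)%E by rewrite tE lte_fin.
have [k2 H2] := limn_einf_gt_eventually tt.
have TT : (tau_sup R z < T'%:E)%E by rewrite TE lte_fin.
have [k3 H3] := limn_esup_lt_eventually TT.
have [k4 H4] := error_le_pow_height hz n0 w0 wW.
have [k5 H5] := eventually_error_lt1 hz n0.
have [k6 H6] := log_height_unbounded hz 0.
pose k0 := maxn k1 (maxn k2 (maxn k3 (maxn k4 (maxn k5 k6)))).
apply: (@window_independent _ _ _ _ _ hz hu k0 w s t' T') => //; first lra.
  move=> k; rewrite !geq_max.
  move=> /andP[/H1 h1 /andP[/H2 h2 /andP[/H3 h3 /andP[/H4 h4 /andP[/H5 h5 /H6 h6]]]]].
  move: h1 h2 h3; rewrite !lte_fin => h1 h2 h3; split=> //.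
  - by rewrite ln_lt0 // (error_gt0 hz).
  - by rewrite lerBrDr ltW.
  - by rewrite !ltW.
by rewrite /t' invrK; move: HT'; rewrite /d /q in qws *; lra.
Qed.

(** Since [1 <= t], the omitted term [1 - 1 / t] is nonnegative, and monotonicity of the logarithm
    yields the previous condition. *)
Lemma eventually_window_independent_simple l : (1 <= l)%N ->
  (l%:R%:E < 1 +
    lne (what Theta * (tau_sup R z - 1) * (sigma_inf Theta z - 1) + 1)
    / lne (tau_sup R z))%E ->
  exists k0, forall k, (k0 <= k)%N -> independent_from R z k l.
Proof.
move=> l1 cond; apply: eventually_window_independent l1 _.
apply: (lt_le_trans cond).
have [t [T [tE TE t1 tT]]] := tau_limits; rewrite tE TE.
(* For [T = 1] both products vanish and the two bounds coincide. *)
have [->|T1] := eqVneq T 1; first by rewrite subee // mule0 !mul0e.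
have {}T1 : 1 < T by rewrite lt_neqAle eq_sym T1 (le_trans t1).
have lnT : 0 < ln T by rewrite ln_gt0.
have P0 := what_sigma_ge0.
have TB : (0 <= T%:E - 1)%E by rewrite sube_ge0 // lee_fin ltW.
rewrite muleAC [(what Theta * _ * _)%E]muleC; set P := (what Theta * _)%E in P0 *.
have ti : (0 <= 1 - 1 / t%:E)%E.
  rewrite inver gt_eqF ?mul1e; last lra.
  by rewrite sube_ge0 // lee_fin invf_le1 //; lra.
have B : ((T%:E - 1) * P + 1 <= (T%:E - 1) * (P + 1 - 1 / t%:E) + 1)%E.
  by rewrite leeD2r // lee_wpmul2l // -addeA leeDl.
have B0 : (0 <= (T%:E - 1) * P + 1)%E by rewrite adde_ge0 // mule_ge0.
rewrite leeD2l // lee_wpmul2r ?inve_ge0 ?lne_ge0 ?lee_fin ?(ltW T1) //.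
by rewrite lee_lne // in_itv /= leey andbT // (le_trans B0).
Qed.

End IndependentWindows.

Theorem theorem4p1 (R : realType) (m n : nat) (hm : (1 <= m)%N)
    (hn : (1 <= n)%N) (Theta : 'M[R]_(m, n))
    (hQ : columns_Qfree Theta) (z : nat -> 'cV[int]_(n + m))
    (hz : best_approximations Theta z) (hu : unique_up_to_sign Theta z) :
  [/\ ((what Theta < +oo)%E ->
       forall eps : R, 0 < eps ->
       exists k0 : nat, forall k : nat, (k0 <= k)%N ->
         (((tau R z k.+1 + (tau R z k)^-1) / (sigma Theta z k - 1) + eps)%:E
            < what Theta)%E ->
         independent_from R z k 3),
      ((1 < sigma_inf Theta z)%E -> (tau_sup R z < +oo)%E ->
       forall l : nat, (1 <= l)%N ->
         (l%:R%:E < 1 +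
            lne ((tau_sup R z - 1) *
                   (what Theta * (sigma_inf Theta z - 1) + 1
                      - 1 / tau_inf R z) + 1)
              / lne (tau_sup R z))%E ->
         exists k0 : nat, forall k : nat, (k0 <= k)%N ->
           independent_from R z k l)
    & ((1 < sigma_inf Theta z)%E -> (tau_sup R z < +oo)%E ->
       forall l : nat, (1 <= l)%N ->
         (l%:R%:E < 1 +
            lne (what Theta * (tau_sup R z - 1) * (sigma_inf Theta z - 1) + 1)
              / lne (tau_sup R z))%E ->
         exists k0 : nat, forall k : nat, (k0 <= k)%N ->
           independent_from R z k l)].
Proof.
split=> [wfin eps eps0|hS hT l l1|hS hT l l1].
- case wE : (what Theta) (what_ge0 Theta hn) wfin => [w| |] // _ _.
  have [k0 H] := three_independent hz hu hn eps0 wE.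
  by exists k0 => k kk0; rewrite lte_fin; exact: H.
- exact: eventually_window_independent.
- exact: eventually_window_independent_simple.
Qed.
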